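(* Let $f$ be an isogeny of complex tori. Then $$e(f)=\min\{n\in\mathbb Z_{>0}\mid n[\rho_r(f)]^{-1}\text{ is integral}\}.$$ Moreover, if $f'$ is the inverse isogeny of $f$, then $$e(f')=\min\left\{n\in\mathbb Z_{>0}\ \left|\ \frac{n}{e(f)}[\rho_r(f)]\text{ is integral}\right.\right\}.$$ Here $[\rho_r(f)]$ is the matrix of the rational representation of $f$ with respect to any choice of bases of the lattices.
   Context: A complex torus of dimension $g$ is a quotient $T=V/L$ of a complex vector space $V$ of dimension $g$ by a lattice $L$ (a discrete subgroup of $V$ of rank $2g$ generating $V$ as a real vector space). A homomorphism $f\colon T_1=V_1/L_1\to T_2=V_2/L_2$ of complex tori (a holomorphic group homomorphism) is induced by a $\mathbb C$-linear map $\rho_a(f)\colon V_1\to V_2$ with $\rho_a(f)(L_1)\subseteq L_2$ (the analytic representation); its restriction $\rho_r(f)\colon L_1\to L_2$ is the rational representation. $[\rho_r(f)]$ denotes the integral matrix of $\rho_r(f)$, of size $2\dim T_2\times 2\dim T_1$, with respect to chosen $\mathbb Z$-bases of $L_1$ and $L_2$. A matrix is integral if all its entries lie in $\mathbb Z$. An isogeny is a surjective homomorphism with finite kernel; for an isogeny, $[\rho_r(f)]$ is a square matrix invertible over $\mathbb Q$, and $[\rho_r(f)]^{-1}$ is its inverse over $\mathbb Q$. The exponent $e(f)$ is the smallest $n\in\mathbb Z_{>0}$ such that $nt=0$ for all $t\in\ker f$. The inverse isogeny of an isogeny $f\colon T_1\to T_2$ is the isogeny $f'\colon T_2\to T_1$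 such that $f\circ f'$ and $f'\circ f$ are multiplication by $e(f)$ on $T_2$ and $T_1$ respectively. *)

(* Defs.v *)
From HB Require Import structures.
From mathcomp Require Import all_boot all_order all_algebra.
From mathcomp Require Import generic_quotient ring_quotient.
From mathcomp Require Import complex.
From mathcomp Require Import all_classical all_reals all_analysis.

Set Implicit Arguments.
Unset Strict Implicit.
Unset Printing Implicit Defensive.

Import Order.TTheory GRing.Theory Num.Theory.
Import numFieldNormedType.Exports.
Import Quotient.

Local Open Scope quotient_scope.
Local Open Scope classical_set_scope.
Local Open Scope ring_scope.

Definition is_min (A : set nat) (n : nat) : Prop :=
  A n /\ forall m, A m -> (n <= m)%N.

Definition is_lin_basis (K : numDomainType) (V : lmodType K) (g : nat)
    (e : 'I_g -> V) : Prop :=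
  forall v, exists! c : 'rV[K]_g, v = \sum_(i < g) c 0 i *: e i.

Definition is_int_basis (V : zmodType) (L : {pred V}) (n : nat)
    (b : 'I_n -> V) : Prop :=
  (forall i, b i \in L) /\
  (forall v, v \in L -> exists! c : 'rV[int]_n, v = \sum_(i < n) b i *~ c 0 i).

(* The norm only serves to fix the topology of [tspace]: on a complex vector
   space of finite dimension all norms define the same one. *)
Record complex_torus (R : realType) (g : nat) := ComplexTorus {
  tspace : normedModType R[i];
  tlattice : zmodClosed tspace;
  tspace_dim : exists e : 'I_g -> tspace, is_lin_basis e;
  tlattice_discrete : forall l, l \in tlattice ->
    \forall x \near l, x \in tlattice -> x = l;
  tlattice_rank : exists b : 'I_(2 * g) -> tspace, is_int_basis tlattice b;
  tlattice_span : forall v : tspace,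
    exists (n : nat) (c : 'I_n -> R) (l : 'I_n -> tspace),
      (forall i, l i \in tlattice) /\ v = \sum_(i < n) (c i)%:C%C *: l i
}.

Definition tpoint (R : realType) (g : nat) (T : complex_torus R g) : zmodType :=
  {quot (tlattice T)}.
Coercion tpoint : complex_torus >-> GRing.Zmodule.type.

Definition tproj (R : realType) (g : nat) (T : complex_torus R g)
  (v : tspace T) : T := \pi_({quot (tlattice T)}) v.

(* The charts of V/L are the local inverses of the projection V -> V/L, so a
   map V1/L1 -> V2/L2 is holomorphic when it is locally induced by complex
   differentiable maps V1 -> V2.  Differentiability is over the scalars R[i]. *)
Definition holomorphic (R : realType) (g1 g2 : nat) (T1 : complex_torus R g1)
    (T2 : complex_torus R g2) (f : T1 -> T2) : Prop :=
  forall v : tspace T1, exists F : tspace T1 -> tspace T2,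
    \forall x \near v, differentiable F x /\ f (tproj x) = tproj (F x).

Record torus_hom (R : realType) (g1 g2 : nat) (T1 : complex_torus R g1)
    (T2 : complex_torus R g2) := TorusHom {
  hom_fun :> {additive T1 -> T2};
  hom_holomorphic : holomorphic hom_fun
}.

Section Hom.
Context (R : realType) (g1 g2 : nat).
Context (T1 : complex_torus R g1) (T2 : complex_torus R g2).
Implicit Type f : torus_hom T1 T2.

(* A homomorphism is induced by exactly one linear map, and the coordinates in
   a basis of L2 are unique, so the default values of [xget] are never used. *)
Definition rho_a f : tspace T1 -> tspace T2 :=
  xget (fun=> 0) [set A : tspace T1 -> tspace T2 |
    linear A /\ forall v, f (tproj v) = tproj (A v)].

(* Column j holds the coordinates of the image of b1 j, so the matrix acts on
   column vectors and has size 2 dim T2 x 2 dim T1. *)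
Definition rho_r_mx f (b1 : 'I_(2 * g1) -> tspace T1)
    (b2 : 'I_(2 * g2) -> tspace T2) : 'M[int]_(2 * g2, 2 * g1) :=
  xget 0 [set M : 'M[int]_(2 * g2, 2 * g1) |
    forall j, rho_a f (b1 j) = \sum_i b2 i *~ M i j].

Definition hom_ker f : set T1 := [set t | f t = 0].

Definition isogeny f : Prop :=
  (forall y, exists x, f x = y) /\ finite_set (hom_ker f).

Definition exponent f : nat :=
  xget 0%N (is_min [set n | (0 < n)%N /\ forall t, hom_ker f t -> t *+ n = 0]).

End Hom.

Definition is_inverse_isogeny (R : realType) (g1 g2 : nat)
    (T1 : complex_torus R g1) (T2 : complex_torus R g2)
    (f : torus_hom T1 T2) (f' : torus_hom T2 T1) : Prop :=
  [/\ isogeny f', forall y, f (f' y) = y *+ exponent f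
    & forall x, f' (f x) = x *+ exponent f].

(* The two dimensions are kept distinct: that they agree for an isogeny is a
   consequence of the existence of a two-sided inverse. *)
Definition is_inverse_mx (K : pzRingType) (m n : nat)
    (M : 'M[K]_(m, n)) (N : 'M[K]_(n, m)) : Prop :=
  M *m N = 1%:M /\ N *m M = 1%:M.

Definition integral_mx (m n : nat) (M : 'M[rat]_(m, n)) : bool :=
  M \is a mxOver Num.int.

(* Main.v *)
From HB Require Import structures.
Require Import Defs.
From mathcomp Require Import all_boot all_order all_algebra.
From mathcomp Require Import generic_quotient ring_quotient complex.
From mathcomp Require Import all_classical all_reals all_analysis.
From mathcomp Require Import ring.
Import Order.TTheory GRing.Theory Num.Theory numFieldNormedType.Exports.
Local Open Scope classical_set_scope.
Local Open Scope ring_scope.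

(** A homomorphism f : V1/L1 -> V2/L2 lifts to a linear map A = rho_a f, and
    n annihilates ker f exactly when n times the inverse of A is integral.
    Indeed tproj v lies in ker f iff A v lies in L2.  As A is injective and its
    image contains L2, the points of ker f are thus the tproj (A^-1 w) for w in
    L2, and n kills all of them iff n A^-1 maps L2 into L1, that is, iff n M^-1
    has integer entries ([annihilates_ker_quasi_inverse],
    [right_quasi_inverse_annihilates]).  Hence e(f), the minimum of the integers
    n > 0 that annihilate ker f, is the minimum of those for which n M^-1 is
    integral ([exponent_min_inverse]).
    For the second formula, f f' = e(f) = f' f gives the same relations between
    the matrices, so the inverse of rho_r f' is M / e(f), and the first formula
    applied to f' is the claim.

    Three facts carry this argument.

    - The lift exists ([linear_lift_exists]).  A local holomorphic lift G with
      G 0 = 0 is additive near 0, since its defect of additivity is small and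
      lies in the discrete group L2; an additive germ that is differentiable at
      0 equals its differential ([locally_additive_diff]), and the differential
      then lifts f everywhere, because every vector is 2^n times a short one.

    - A is injective ([rho_a_inj]).  If A v = 0, the whole complex line of v
      projects into the finite group ker f; multiplied by an integer that
      annihilates ker f it lies in L1, but a discrete group contains no line.

    - Every element of L2 is in the image of A ([rho_a_onto_lattice]).  Since f
      is onto, V2 = A V1 + L2, and halving the basis of L2 gives
      b2 (1 - 2 C) \in A V1 for an integer matrix C; the determinant of 1 - 2 C
      is odd, hence nonzero, so the basis itself is in the image.  This is
      Nakayama's argument, with the prime 2 acting on the finitely generated
      group V2 / A V1. *)

Set Implicit Arguments.
Unset Strict Implicit.
Unset Printing Implicit Defensive.

(** * Integer combinations of families of vectors *)

(** Integer matrices act on the right on families of vectors; a family written as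
    a row b becomes the row b P.  This turns identities between lattice vectors
    into identities between matrices. *)
Definition lincomb (V : zmodType) (m n : nat) (b : 'I_m -> V) (P : 'M[int]_(m, n))
  : 'I_n -> V := fun j => \sum_i b i *~ P i j.

Lemma lincombA (V : zmodType) (m n p : nat) (b : 'I_m -> V)
    (P : 'M[int]_(m, n)) (Q : 'M[int]_(n, p)) (j : 'I_p) :
  lincomb (lincomb b P) Q j = lincomb b (P *m Q) j.
Proof.
rewrite /lincomb; under eq_bigr do rewrite mulrz_suml.
rewrite exchange_big /=; apply: eq_bigr => i _; rewrite mxE mulrz_sumr.
by apply: eq_bigr => k _; rewrite mulrzA.
Qed.

Lemma lincomb_scalar (V : zmodType) (n : nat) (b : 'I_n -> V) (a : int) j :
  lincomb b a%:M j = b j *~ a.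
Proof.
rewrite /lincomb (bigD1 j) //= big1 => [|i ne_ij]; rewrite mxE ?eqxx ?addr0 //.
by rewrite (negPf ne_ij).
Qed.

Lemma lincombB (V : zmodType) (m n : nat) (b : 'I_m -> V) (P Q : 'M[int]_(m, n)) j :
  lincomb b (P - Q) j = lincomb b P j - lincomb b Q j.
Proof.
by rewrite /lincomb -sumrB; apply: eq_bigr => i _; rewrite !mxE mulrzBr.
Qed.

Lemma lincomb_linear (K : pzRingType) (V W : lmodType K) (A : {linear V -> W})
    (m n : nat) (b : 'I_m -> V) (P : 'M[int]_(m, n)) j :
  A (lincomb b P j) = lincomb (A \o b) P j.
Proof. by rewrite raddf_sum; apply: eq_bigr => i _; rewrite raddfMz. Qed.

Lemma eq_lincomb (V : zmodType) (m n : nat) (b c : 'I_m -> V)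
    (P : 'M[int]_(m, n)) : b =1 c -> lincomb b P =1 lincomb c P.
Proof. by move=> eq_bc j; apply: eq_bigr => i _; rewrite eq_bc. Qed.

Section IntBasis.
Context (V : zmodType) (L : zmodClosed V) (n : nat) (b : 'I_n -> V).
Context (b_basis : is_int_basis L b).

Lemma int_basis_coord m (v : 'I_m -> V) :
  (forall j, v j \in L) -> exists P : 'M[int]_(n, m), forall j, v j = lincomb b P j.
Proof.
move=> Lv.
have /choice[c vE] : forall j, exists c : 'rV[int]_n,
      v j = \sum_i b i *~ c 0 i.
  by move=> j; have [c [vE _]] := b_basis.2 _ (Lv j); exists c.
exists (\matrix_(i, j) c j 0 i) => j; rewrite vE.
by apply: eq_bigr => i _; rewrite mxE.
Qed.

Lemma int_basis_inj m (P Q : 'M[int]_(n, m)) :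
  (forall j, lincomb b P j = lincomb b Q j) -> P = Q.
Proof.
move=> eqPQ; apply/trmx_inj/row_matrixP => j; rewrite -!tr_col.
have Lv : lincomb b P j \in L.
  by apply: rpred_sum => i _; rewrite rpredMz ?b_basis.1.
have [c [_ c_uniq]] := b_basis.2 _ Lv.
have cE (S : 'M[int]_(n, m)) : lincomb b P j = lincomb b S j -> c = (col j S)^T.
  move=> vE; apply: c_uniq; rewrite vE; apply: eq_bigr => i _.
  by rewrite !mxE.
by rewrite -(cE P) // -(cE Q).
Qed.

End IntBasis.

(** * Additive germs *)

Lemma pow2_unbounded (R : realType) (x : R[i]) :
  0 <= x -> exists n, x < (2 ^ n)%:R.
Proof.
move=> x_ge0; have x_real := ger0_real x_ge0.
exists (Num.bound `|complex.Re x|).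
have Re_lt : complex.Re x < (2 ^ Num.bound `|complex.Re x|)%:R.
  apply: le_lt_trans (ler_norm _) _.
  apply: lt_trans (archi_boundP (normr_ge0 _)) _.
  by rewrite ltr_nat ltn_expl.
by rewrite -(RRe_real x_real) -(rmorph_nat (real_complex R)) ltcR.
Qed.

(** Reduces statements about all vectors to short vectors.  Powers of 2 are used
    because they can be reached by successive doublings that stay in a ball. *)
Lemma shrink_into_ball (R : realType) (V : normedModType R[i])
    (r : R[i]) (v : V) :
  0 < r -> exists n (w : V), `|w| < r /\ v = w *+ 2 ^ n.
Proof.
move=> r_gt0.
have [n lt_n] := pow2_unbounded (divr_ge0 (normr_ge0 v) (ltW r_gt0)).
have pow_gt0 : 0 < (2 ^ n)%:R :> R[i] by rewrite ltr0n expn_gt0.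
exists n, ((2 ^ n)%:R^-1 *: v); split.
  rewrite normrZ gtr0_norm ?invr_gt0 // mulrC ltr_pdivrMr //.
  by rewrite mulrC -ltr_pdivrMr.
by rewrite -scaler_nat scalerA divff ?scale1r // gt_eqF.
Qed.

(** The difference D of G and its differential is additive near 0 and o(|x|).
    Additivity gives D x = 2^n D (x / 2^n), so the bound |D y| <= eps |y|, valid
    for very short y, holds on the whole ball, for every eps > 0. *)
Lemma locally_additive_diff (R : realType) (V W : normedModType R[i])
    (G : V -> W) (r : R[i]) :
  (forall x y, `|x| < r -> `|y| < r -> G (x + y) = G x + G y) ->
  differentiable G 0 -> forall x, `|x| < r -> G x = 'd G 0 x.
Proof.
move=> G_add G_diff x x_lt; pose D y := G y - 'd G 0 y.
have r_gt0 : 0 < r by apply: le_lt_trans x_lt.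
have G0 : G 0 = 0.
  have := G_add 0 0; rewrite normr0 addr0 => /(_ r_gt0 r_gt0) /esym/eqP.
  by rewrite -subr_eq0 addrK => /eqP.
have D_double y : `|y| < r -> D (y + y) = D y + D y.
  by move=> y_lt; rewrite /D G_add // linearD opprD addrACA.
have half_lt (y : V) n : `|y *+ 2 ^ n| < r -> `|y| < r.
  apply: le_lt_trans; rewrite normrMn -{1}[`|y|]mulr1n.
  by rewrite ler_wpMn2l ?expn_gt0.
have D_pow y n : `|y *+ 2 ^ n| < r -> D (y *+ 2 ^ n) = D y *+ 2 ^ n.
  elim: n => // n IHn; rewrite expnSr !mulrnA mulr2n => lt_r.
  have lt_r1 : `|y *+ 2 ^ n| < r.
    by apply: (half_lt _ 1%N); rewrite expn1 mulr2n.
  by rewrite D_double ?IHn ?mulr2n.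
have D_small eps : 0 < eps -> `|D x| <= eps * `|x|.
  move=> eps_gt0.
  have /eqaddoP /(_ _ eps_gt0) /nbhs_norm0P [s s_gt0 Ds] := diff_locally G_diff.
  have [n [w [w_lt xE]]] := shrink_into_ball x s_gt0.
  rewrite xE in x_lt *; rewrite D_pow // !normrMn mulrnAr ler_wMn2r //.
  have := Ds w w_lt.
  by rewrite /D /= !fctE /= addr0 G0 add0r.
apply/eqP; rewrite -subr_eq0 -[_ - _]/(D x); apply: contraT => Dx_neq0.
have x_neq0 : x != 0.
  by apply: contraNneq Dx_neq0 => ->; rewrite /D G0 linear0 subrr.
(* With eps = |D x| / (2 |x|) the bound reads |D x| <= |D x| / 2. *)
have := D_small (`|D x| / (`|x| *+ 2)).
rewrite divr_gt0 ?normr_gt0 ?pmulrn_lgt0 ?normr_gt0 // => /(_ isT).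
rewrite -mulr_natr invfM mulrA mulrAC divfK ?normr_eq0 //.
rewrite ler_pdivlMr ?ltr0n // ger_pMr ?normr_gt0 //.
by rewrite (ler_nat _ 2 1).
Qed.

(** * Linear lifts of homomorphisms *)

Section Torus.
Context (R : realType) (g : nat) (T : complex_torus R g).

Lemma tproj_is_zmod_morphism : zmod_morphism (@tproj R g T).
Proof. by move=> x y; rewrite /tproj raddfB. Qed.

HB.instance Definition _ := GRing.isZmodMorphism.Build (tspace T) T
  (@tproj R g T) tproj_is_zmod_morphism.

Lemma tproj_eq0 (v : tspace T) : (tproj v == 0) = (v \in tlattice T).
Proof.
by rewrite -[v in RHS]subr0 Quotient.idealrBE -(raddf0 (@tproj R g T)).
Qed.

Lemma tproj_surj (t : T) : exists v, t = tproj v.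
Proof. by exists (repr t); rewrite /tproj reprK. Qed.

Lemma lattice_gap :
  exists2 r : R[i], 0 < r & forall l, l \in tlattice T -> `|l| < r -> l = 0.
Proof.
have /nbhs_norm0P [r r_gt0 gap] := tlattice_discrete (rpred0 (tlattice T)).
by exists r => // l Ll l_lt; apply: gap.
Qed.

Lemma lattice_no_line (v : tspace T) :
  (forall t : R[i], t *: v \in tlattice T) -> v = 0.
Proof.
move=> Lv; have [r r_gt0 gap] := lattice_gap.
have [n [w [w_lt vE]]] := shrink_into_ball v r_gt0.
rewrite vE (gap w) ?mul0rn //.
suff -> : w = (2 ^ n)%:R^-1 *: v by [].
by rewrite vE -[w *+ _]scaler_nat scalerA mulVf ?scale1r.
Qed.

End Torus.

Section Lift.
Context (R : realType) (g1 g2 : nat).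
Context (T1 : complex_torus R g1) (T2 : complex_torus R g2).
Implicit Type f : torus_hom T1 T2.

(** A local lift of f, shifted to vanish at 0, is additive near 0: its defect
    G (x + y) - (G x + G y) lies in the lattice and is shorter than every nonzero
    lattice vector. *)
Lemma linear_lift_exists f : exists A : tspace T1 -> tspace T2,
  linear A /\ forall v, f (tproj v) = tproj (A v).
Proof.
have [F nearF] := hom_holomorphic f 0.
have [F_diff F_0] := nbhs_singleton nearF.
pose G v := F v - F 0.
have G_diff : differentiable G 0 by apply: differentiableB.
have G_cont : G v @[v --> 0] --> G 0 by apply: differentiable_continuous.
have G_lift v : f (tproj v) = tproj (F v) -> f (tproj v) = tproj (G v).
  by move=> fE; rewrite raddfB /= -fE -F_0 !raddf0 addr0.
have [e e_gt0 gap] := lattice_gap T2.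
(* The defect of additivity has three terms, each below a third of the gap. *)
have e3_gt0 : 0 < e / 3%:R by rewrite divr_gt0 ?ltr0n.
have /nbhs_norm0P [r r_gt0 r_ball] : \forall v \near 0,
    f (tproj v) = tproj (G v) /\ `|G v| < e / 3%:R.
  have G_small : \forall v \near 0, `|G v| < e / 3%:R.
    by apply: (cvgr_norm_lt _ G_cont); rewrite /G subrr normr0.
  near=> v; split; last by near: v.
  by apply: G_lift; near: v; apply: filterS nearF => ? [].
have G_add x y : `|x| < r / 2%:R -> `|y| < r / 2%:R -> G (x + y) = G x + G y.
  move=> x_lt y_lt; have half_lt : r / 2%:R < r.
    by rewrite ltr_pdivrMr ?ltr0n // ltr_pMr // (ltr_nat _ 1 2).
  have [fx Gx] := r_ball x (lt_trans x_lt half_lt).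
  have [fy Gy] := r_ball y (lt_trans y_lt half_lt).
  have [fxy Gxy] :
      f (tproj (x + y)) = tproj (G (x + y)) /\ `|G (x + y)| < e / 3%:R.
    apply: r_ball => /=; apply: le_lt_trans (ler_normD _ _) _.
    by rewrite [r]splitr ltrD.
  apply/eqP; rewrite -subr_eq0; apply/eqP/gap.
    rewrite -tproj_eq0 raddfB (raddfD _ (G x)) /= -fx -fy -fxy.
    by rewrite subr_eq0 !raddfD.
  apply: le_lt_trans (ler_normB _ _) _.
  have -> : e = e / 3%:R + (e / 3%:R + e / 3%:R) by field.
  by rewrite ltrD // (le_lt_trans (ler_normD _ _)) // ltrD.
exists ('d G 0); split; first exact: linearP.
move=> v; have r2_gt0 : 0 < r / 2%:R by rewrite divr_gt0 ?ltr0n.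
have [n [w [w_lt ->]]] := shrink_into_ball v r2_gt0.
rewrite !raddfMn /= -(locally_additive_diff G_add G_diff w_lt).
congr (_ *+ _); apply: (r_ball w _).1 => /=; apply: lt_trans w_lt _.
by rewrite ltr_pdivrMr ?ltr0n // ltr_pMr // (ltr_nat _ 1 2).
Unshelve. all: by end_near.
Qed.

Lemma rho_a_linear f : linear (rho_a f).
Proof. by have [] := xgetPex (fun=> 0) (linear_lift_exists f). Qed.

HB.instance Definition _ f := GRing.isLinear.Build R[i] (tspace T1) (tspace T2)
  *:%R (rho_a f) (rho_a_linear f).

Lemma tproj_rho_a f v : f (tproj v) = tproj (rho_a f v).
Proof. by have [] := xgetPex (fun=> 0) (linear_lift_exists f). Qed.

Lemma rho_a_lattice f l : l \in tlattice T1 -> rho_a f l \in tlattice T2.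
Proof. by rewrite -!tproj_eq0 -tproj_rho_a => /eqP ->; rewrite raddf0. Qed.

Lemma rho_r_mxP f (b1 : 'I_(2 * g1) -> tspace T1)
    (b2 : 'I_(2 * g2) -> tspace T2) :
  is_int_basis (tlattice T1) b1 -> is_int_basis (tlattice T2) b2 ->
  forall j, rho_a f (b1 j) = lincomb b2 (rho_r_mx f b1 b2) j.
Proof.
move=> b1_basis b2_basis.
have [P PE] :=
  int_basis_coord b2_basis (fun j => rho_a_lattice f (b1_basis.1 j)).
have MP : exists M, [set M : 'M[int]_(2 * g2, 2 * g1) |
    forall j, rho_a f (b1 j) = \sum_i b2 i *~ M i j] M by exists P.
exact: (xgetPex 0 MP).
Qed.

End Lift.

(** * The analytic representation of an isogeny *)

Definition annihilates_ker (R : realType) (g1 g2 : nat)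
    (T1 : complex_torus R g1) (T2 : complex_torus R g2) (f : torus_hom T1 T2)
    (n : nat) : Prop :=
  forall t, hom_ker f t -> t *+ n = 0.

(** Modulo 2 the matrix is the identity, so its determinant is odd. *)
Lemma det_one_sub_double_neq0 (n : nat) (C : 'M[int]_n) :
  \det (1%:M - C *+ 2) != 0.
Proof.
have: (\det (1%:M - C *+ 2))%:~R = 1 :> 'F_2.
  rewrite mulr2n -det_map_mx map_mxB map_mxD map_mx1 -[RHS](det1 _ n).
  congr (\det _); apply/matrixP => i j; rewrite !mxE.
  by rewrite addrr_pchar2 ?pchar_Fp ?subr0.
by apply: contra_eqN => /eqP ->; rewrite eq_sym oner_neq0.
Qed.

Lemma exists_min (P : nat -> Prop) : (exists n, P n) -> exists n, is_min P n.
Proof.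
move=> exP.
have exPb : exists n, `[< P n >].
  by case: exP => n Pn; exists n; apply/asboolP.
case: (ex_minnP exPb) => n /asboolP Pn min_n.
by exists n; split=> // m Pm; apply/min_n/asboolP.
Qed.

Section Isogeny.
Context (R : realType) (g1 g2 : nat).
Context (T1 : complex_torus R g1) (T2 : complex_torus R g2).
Context (f : torus_hom T1 T2).
Context (b1 : 'I_(2 * g1) -> tspace T1) (b2 : 'I_(2 * g2) -> tspace T2).
Context (b1_basis : is_int_basis (tlattice T1) b1).
Context (b2_basis : is_int_basis (tlattice T2) b2).
Context (f_isogeny : isogeny f).

Local Notation M := (rho_r_mx f b1 b2).

(** If s lists ker f, two of the multiples 0 t, ..., (size s) t of a kernel point
    t agree by the pigeonhole principle; so t has order at most size s, and the
    factorial of size s is a common multiple of all these orders. *)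
Lemma isogeny_ker_annihilated :
  exists2 n, (0 < n)%N & annihilates_ker f n.
Proof.
have [s kerE] := (finite_seqP _).1 f_isogeny.2.
exists (size s)`!; first exact: fact_gt0.
move=> t ft0.
have : ~~ uniq (mkseq (fun k => t *+ k) (size s).+1).
  apply/negP => t_uniq; suff : (size s < size s)%N by rewrite ltnn.
  rewrite -[X in (X <= _)%N](size_mkseq (fun k => t *+ k)).
  apply: uniq_leq_size => // _ /mapP[k _ ->].
  have : hom_ker f (t *+ k) by rewrite /hom_ker /= raddfMn /= ft0 mul0rn.
  by rewrite kerE.
case/(uniqPn 0) => i [j [lt_ij]]; rewrite size_mkseq => lt_js.
rewrite !nth_mkseq ?(ltn_trans lt_ij) // => eq_t.
have tji : t *+ (j - i) = 0 by rewrite mulrnBr ?(ltnW lt_ij) // eq_t subrr.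
have /dvdnP[q ->] : (j - i %| (size s)`!)%N.
  by rewrite dvdn_fact // subn_gt0 lt_ij (leq_trans (leq_subr _ _)).
by rewrite mulnC mulrnA tji mul0rn.
Qed.

Lemma exponentP :
  is_min [set n | (0 < n)%N /\ annihilates_ker f n] (exponent f).
Proof.
apply: (@xgetPex _ 0%N (is_min _)); apply: exists_min.
by have [n n_gt0 fn] := isogeny_ker_annihilated; exists n.
Qed.

(** The line of v maps to 0, so it projects into the finite group ker f and
    n t v \in L1 for all scalars t; dividing t by n, the line is in L1. *)
Lemma rho_a_inj v : rho_a f v = 0 -> v = 0.
Proof.
move=> Av0; have [n n_gt0 fn] := isogeny_ker_annihilated.
apply: lattice_no_line => t.
have /fn : hom_ker f (tproj ((n%:R^-1 * t) *: v)).
  by rewrite /hom_ker /= tproj_rho_a linearZ /= Av0 scaler0 raddf0.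
rewrite -raddfMn => /eqP; rewrite tproj_eq0 -scaler_nat !scalerA mulrA.
by rewrite mulfV ?mul1r // pnatr_eq0 -lt0n.
Qed.

(** Approximating b2 i / 2 by the image of A modulo L2 gives b2 (1 - 2 C) in the
    image; the adjugate then gives det(1 - 2 C) b2 i in the image, which is a
    complex subspace, so the nonzero determinant can be divided out. *)
Lemma rho_a_onto_lattice l : l \in tlattice T2 -> exists v, rho_a f v = l.
Proof.
have mod_lattice w : exists v, w - rho_a f v \in tlattice T2.
  have [t ft] := f_isogeny.1 (tproj w); have [v tE] := tproj_surj t.
  by exists v; rewrite -tproj_eq0 raddfB /= -tproj_rho_a -tE ft subrr.
have /choice[v Lv] : forall i, exists v,
    2%:R^-1 *: b2 i - rho_a f v \in tlattice T2.
  by move=> i; apply: mod_lattice.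
have [C CE] := int_basis_coord b2_basis Lv.
pose D := 1%:M - C *+ 2.
have b2D i : lincomb b2 D i = rho_a f (v i *+ 2).
  rewrite lincombB lincomb_scalar mulr1z mulr2n.
  have -> : lincomb b2 (C + C) i = lincomb b2 C i *+ 2.
    rewrite mulr2n /lincomb -big_split /=; apply: eq_bigr => k _.
    by rewrite mxE mulrzDr.
  rewrite -CE mulrnBl -scaler_nat scalerA mulfV ?pnatr_eq0 // scale1r subKr.
  by rewrite raddfMn.
have b2_onto i : exists u, rho_a f u = b2 i.
  have : rho_a f (lincomb (fun i => v i *+ 2) (\adj D) i) =
      (\det D)%:~R *: b2 i.
    rewrite lincomb_linear (eq_lincomb _ (c := lincomb b2 D)) => [|k /=].
      by rewrite lincombA mul_mx_adj lincomb_scalar scaler_int.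
    by rewrite b2D.
  move=> uE; exists ((\det D)%:~R^-1 *: lincomb (fun i => v i *+ 2) (\adj D) i).
  rewrite linearZ /= uE scalerA mulVf ?scale1r // intr_eq0.
  exact: det_one_sub_double_neq0.
have /choice[u uE] := b2_onto.
move=> Ll; have [c [-> _]] := b2_basis.2 _ Ll.
exists (\sum_i u i *~ c 0 i); rewrite raddf_sum.
by apply: eq_bigr => i _; rewrite raddfMz /= uE.
Qed.

(** The columns of N are the coordinates of n A^-1 (b2 i): these vectors lie in
    L1 because A^-1 (b2 i) projects into ker f.  That N is also a left
    quasi-inverse follows from M (N M - n) = 0, as A is injective. *)
Lemma annihilates_ker_quasi_inverse (n : nat) : annihilates_ker f n ->
  exists N, M *m N = (n : int)%:M /\ N *m M = (n : int)%:M.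
Proof.
move=> fn.
have /choice[v vE] : forall i, exists v, rho_a f v = b2 i.
  by move=> i; apply: rho_a_onto_lattice; apply: b2_basis.1.
have Lv i : v i *+ n \in tlattice T1.
  rewrite -tproj_eq0 raddfMn; apply/eqP/fn.
  rewrite /hom_ker /= tproj_rho_a vE; apply/eqP.
  by rewrite tproj_eq0; apply: b2_basis.1.
have [N NE] := int_basis_coord b1_basis Lv.
have AbE := rho_r_mxP f b1_basis b2_basis.
have MN : M *m N = (n : int)%:M.
  apply: (int_basis_inj b2_basis) => j.
  rewrite lincomb_scalar -lincombA -(eq_lincomb _ AbE).
  by rewrite -[lincomb _ _ _](lincomb_linear (rho_a f)) -NE raddfMn /= vE.
exists N; split=> //; apply: (int_basis_inj b1_basis) => j.
apply/eqP; rewrite -subr_eq0 -lincombB; apply/eqP/rho_a_inj.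
rewrite lincomb_linear (eq_lincomb _ AbE) lincombA mulmxBr mulmxA MN.
by rewrite scalar_mxC subrr /lincomb big1 // => i _; rewrite mxE.
Qed.

(** If A v = b2 C lies in L2, then A (n v) = b2 M N C = A (b1 N C), so injectivity
    of A puts n v in L1. *)
Lemma right_quasi_inverse_annihilates (n : nat) (N : 'M[int]_(2 * g1, 2 * g2)) :
  M *m N = (n : int)%:M -> annihilates_ker f n.
Proof.
move=> MN t; have [v ->] := tproj_surj t => fv0.
have Lv : rho_a f v \in tlattice T2.
  by rewrite -tproj_eq0 -tproj_rho_a; apply/eqP.
have [C CE] := int_basis_coord b2_basis (fun _ : 'I_1 => Lv).
have AbE := rho_r_mxP f b1_basis b2_basis.
rewrite -raddfMn; apply/eqP; rewrite tproj_eq0.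
suff -> : v *+ n = lincomb b1 (N *m C) 0.
  by apply: rpred_sum => i _; rewrite rpredMz ?b1_basis.1.
apply/eqP; rewrite -subr_eq0; apply/eqP/rho_a_inj.
rewrite raddfB /= lincomb_linear (eq_lincomb _ AbE) lincombA mulmxA MN.
rewrite -scalar_mxC -lincombA lincomb_scalar -CE raddfMn.
by rewrite /= -pmulrn subrr.
Qed.

Lemma exponent_gt0 : (0 < exponent f)%N.
Proof. by have [[]] := exponentP. Qed.

Lemma rho_r_mx_invertible :
  exists N : 'M[rat]_(2 * g1, 2 * g2), is_inverse_mx (map_mx intr M) N.
Proof.
have [N [MN NM]] := annihilates_ker_quasi_inverse exponentP.1.2.
have e_neq0 : (exponent f)%:R != 0 :> rat.
  by rewrite pnatr_eq0 -lt0n exponent_gt0.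
exists ((exponent f)%:R^-1 *: map_mx intr N).
by split; rewrite -?scalemxAl -?scalemxAr -map_mxM ?MN ?NM map_scalar_mx
  scale_scalar_mx /= -pmulrn mulVf.
Qed.

(** An integral n N is an integer matrix P with M P = n, so n annihilates ker f;
    conversely an integer quasi-inverse for n must equal n N. *)
Lemma exponent_min_inverse (N : 'M[rat]_(2 * g1, 2 * g2)) :
  is_inverse_mx (map_mx intr M) N ->
  is_min [set n | (0 < n)%N /\ integral_mx (n%:R *: N)] (exponent f).
Proof.
move=> [MN NM].
have integralE n : integral_mx (n%:R *: N) <-> annihilates_ker f n.
  split=> [int_nN | /annihilates_ker_quasi_inverse[N' [MN' _]]].
    pose P := map_mx Num.floor (n%:R *: N).
    have PE : map_mx intr P = n%:R *: N.
      by apply/matrixP => i j; rewrite 2!mxE floorK // (mxOverP int_nN).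
    apply: (@right_quasi_inverse_annihilates _ P).
    have MP : map_mx (intr : int -> rat) (M *m P) = map_mx intr (n : int)%:M.
      rewrite map_mxM PE -scalemxAr MN map_scalar_mx scale_scalar_mx mulr1.
      by rewrite /= -pmulrn.
    apply/matrixP => i j; have /matrixP/(_ i j) := MP.
    by rewrite mxE [RHS]mxE => /intr_inj.
  suff -> : n%:R *: N = map_mx intr N'.
    by apply/mxOverP => i j; rewrite mxE intr_int.
  rewrite -[RHS]mul1mx -NM -mulmxA -map_mxM MN' map_scalar_mx.
  by rewrite mul_mx_scalar /= -pmulrn.
have [[e_gt0 /integralE e_int] e_min] := exponentP; split=> // m.
by move=> [m_gt0 /integralE ann_m]; apply: e_min.
Qed.

End Isogeny.

(** * Inverse isogenies *)

Section Composite.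
Context (R : realType) (g1 g2 : nat).
Context (T1 : complex_torus R g1) (T2 : complex_torus R g2).
Context (f : torus_hom T1 T2) (f' : torus_hom T2 T1) (e : nat).

(** The linear map rho_a f \o rho_a f' - e takes its values in the lattice, and so
    vanishes: its image is a complex subspace. *)
Lemma rho_a_comp_mulrn : (forall y, f (f' y) = y *+ e) ->
  forall w, rho_a f (rho_a f' w) = w *+ e.
Proof.
move=> ff'E w.
pose D v := rho_a f (rho_a f' v) - v *+ e.
suff : D w = 0 by move/eqP; rewrite subr_eq0 => /eqP.
apply: lattice_no_line => t.
have -> : t *: D w = D (t *: w) by rewrite /D /= !linearZ /= scalerBr scalerMnr.
rewrite -tproj_eq0 raddfB raddfMn /= -!tproj_rho_a.
by rewrite ff'E subrr.
Qed.

Lemma rho_r_mx_comp_mulrn (b1 : 'I_(2 * g1) -> tspace T1)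
    (b2 : 'I_(2 * g2) -> tspace T2) :
  is_int_basis (tlattice T1) b1 -> is_int_basis (tlattice T2) b2 ->
  (forall y, f (f' y) = y *+ e) ->
  rho_r_mx f b1 b2 *m rho_r_mx f' b2 b1 = (e : int)%:M.
Proof.
move=> b1_basis b2_basis /rho_a_comp_mulrn AA'.
apply: (int_basis_inj b2_basis) => j; rewrite lincomb_scalar -lincombA.
rewrite -(eq_lincomb _ (rho_r_mxP f b1_basis b2_basis)).
rewrite -[lincomb _ _ _](lincomb_linear (rho_a f)).
rewrite -(rho_r_mxP f' b2_basis b1_basis).
by rewrite /= AA'.
Qed.

End Composite.

Unset Implicit Arguments.

Theorem corollary9 (R : realType) (g1 g2 : nat)
    (T1 : complex_torus R g1) (T2 : complex_torus R g2) (f : torus_hom T1 T2)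
    (b1 : 'I_(2 * g1) -> tspace T1) (b2 : 'I_(2 * g2) -> tspace T2)
    (b1_basis : is_int_basis (tlattice T1) b1)
    (b2_basis : is_int_basis (tlattice T2) b2)
    (f_isogeny : isogeny f) :
  let M : 'M[rat]_(2 * g2, 2 * g1) := map_mx intr (rho_r_mx f b1 b2) in
  (exists N : 'M[rat]_(2 * g1, 2 * g2), is_inverse_mx M N /\
     is_min [set n : nat | (0 < n)%N /\ integral_mx (n%:R *: N)] (exponent f)) /\
  (forall f' : torus_hom T2 T1, is_inverse_isogeny f f' ->
     is_min [set n : nat | (0 < n)%N /\
               integral_mx ((n%:R / (exponent f)%:R) *: M)] (exponent f')).
Proof.
move=> M; split.
  have [N MN] := rho_r_mx_invertible b1_basis b2_basis f_isogeny.
  by exists N; split=> //; apply: exponent_min_inverse MN.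
move=> f' [f'_isogeny ff'E f'fE].
have e_neq0 : (exponent f)%:R != 0 :> rat.
  by rewrite pnatr_eq0 -lt0n exponent_gt0.
have M'_inv : is_inverse_mx (map_mx intr (rho_r_mx f' b2 b1))
    ((exponent f)%:R^-1 *: M).
  split; rewrite -?scalemxAr -?scalemxAl -map_mxM.
    by rewrite (rho_r_mx_comp_mulrn b2_basis b1_basis f'fE) map_scalar_mx
      scale_scalar_mx /= -pmulrn mulVf.
  by rewrite (rho_r_mx_comp_mulrn b1_basis b2_basis ff'E) map_scalar_mx
    scale_scalar_mx /= -pmulrn mulVf.
have := exponent_min_inverse b2_basis b1_basis f'_isogeny M'_inv.
by under [in X in X -> _]eq_set do rewrite scalerA.
Qed.
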